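(* For each positive integer $n$, let $\mathcal{T}_n : M_n(\mathbb{R}) \to M_n(\mathbb{R})$ be the triangular cut, $\mathcal{T}_n(A) = A \circ T_n$. Then (all suprema being taken over nonzero matrices $A$): (i) $\displaystyle \sup_{A \in M_n(\mathbb{R})} \frac{\|\mathcal{T}_n(A)\|_{\Box}}{\|A\|_{\Box}} \to \infty$ as $n \to \infty$; (ii) $\displaystyle \sup_{A \in \mathcal{S}_n(\mathbb{R})} \frac{\|\mathcal{T}_n(A)\|_{\Box}}{\|A\|_{\Box}} \to \infty$ as $n \to \infty$; (iii) $\displaystyle \sup_{A \in \mathcal{S}_n(\mathbb{R})} \frac{\|\mathcal{T}_n(A)\|_{\mathrm{opr}}}{\|A\|_{\mathrm{opr}}} \to \infty$ as $n \to \infty$.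
   Context: $M_n(\mathbb{R})$ is the space of real $n \times n$ matrices and $\mathcal{S}_n(\mathbb{R})$ is its subspace of symmetric matrices. The matrix $T_n \in M_n(\mathbb{R})$ is defined by $(T_n)_{ij} = 1$ if $i \geq j$ and $(T_n)_{ij} = 0$ if $i < j$. The symbol $\circ$ denotes the Schur (entrywise) product of matrices. For an $n \times n$ real matrix $A = (a_{ij})$, with $[n] = \{1,\dots,n\}$, the cut norm is $$\|A\|_{\Box} = \frac{1}{n^2} \sup_{S,T \subseteq [n]} \Big| \sum_{i \in S,\, j \in T} a_{ij} \Big|,$$ and $\|A\|_{\mathrm{opr}} = \sup_{\|x\|_2 \leq 1} \|Ax\|_2$ is the operator norm of $A$ with respect to the Euclidean norm. *)

(* Defs.v *)
From mathcomp Require Import all_boot all_order all_algebra.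
From mathcomp Require Import all_classical all_reals all_analysis.

Set Implicit Arguments.
Unset Strict Implicit.
Unset Printing Implicit Defensive.

Import Order.TTheory GRing.Theory Num.Theory.
Import numFieldNormedType.Exports.

Local Open Scope classical_set_scope.
Local Open Scope ring_scope.

Definition schur_mul (R : realType) (n : nat) (A B : 'M[R]_n) : 'M[R]_n :=
  map2_mx *%R A B.

Definition tri_mx (R : realType) (n : nat) : 'M[R]_n :=
  \matrix_(i, j) (j <= i)%N%:R.

Definition tri_cut (R : realType) (n : nat) (A : 'M[R]_n) : 'M[R]_n :=
  schur_mul A (tri_mx R n).

Definition cut_norm (R : realType) (n : nat) (A : 'M[R]_n) : R :=
  (n%:R ^+ 2)^-1 *
  sup [set `|\sum_(i in ST.1) \sum_(j in ST.2) A i j|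
      | ST in [set: {set 'I_n} * {set 'I_n}]].

(* The norm `|x| that the library puts on matrices is the max norm, not this
   one. *)
Definition l2norm (R : realType) (n : nat) (x : 'cV[R]_n) : R :=
  Num.sqrt (\sum_(i < n) x i 0 ^+ 2).

Definition opr_norm (R : realType) (n : nat) (A : 'M[R]_n) : R :=
  sup [set l2norm (A *m x) | x in [set x : 'cV[R]_n | l2norm x <= 1]].

(* The supremum is taken in the extended reals because the real-valued [sup] is
   0 on a set that is empty or not bounded above.  For n = 0 there is no nonzero
   matrix and the value is -oo, which does not affect limits as n --> \oo. *)
Definition sup_ratio (R : realType) (n : nat) (N : 'M[R]_n -> R)
    (D : set 'M[R]_n) : \bar R :=
  ereal_sup [set (N (tri_cut A) / N A)%:E | A in D `&` [set A | A != 0]].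

Definition sym_mx (R : realType) (n : nat) : set 'M[R]_n :=
  [set A | A^T = A].

(* Main.v *)
Require Import Defs.
From mathcomp Require Import all_boot all_order all_algebra.
From mathcomp Require Import all_classical all_reals all_analysis.
From mathcomp Require Import ring lra zify.

Import Order.TTheory GRing.Theory Num.Theory.
Import numFieldNormedType.Exports.

Local Open Scope classical_set_scope.
Local Open Scope ring_scope.

(** A single family of symmetric matrices proves the three limits. Let [H] be
    the antisymmetric matrix with entries [1 / (i - j)] off the diagonal and [0]
    on it. By Hilbert's inequality its operator norm is bounded independently of
    [n] ([hilbert_inequality]), although its lower triangular part has entries
    of one sign whose sum is of order [n log n]. To make the example symmetric,
    let [D] be the diagonal matrix of the parities of the indices and take
    [A = D H - H D], with entries [(odd i - odd j) / (i - j)]. Its operator norm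
    is still bounded, by [4] ([opr_norm_parity_hilbert]), and on odd rows and
    even columns it agrees with [H]; there the triangular cut keeps positive
    entries whose sum is at least a multiple of [n] times a harmonic sum
    ([tri_cut_parity_hilbert_sum]).

    The two norms are compared by [cut_norm A <= opr_norm A / n]
    ([cut_norm_le_opr_norm]). Hence [cut_norm A <= 4 / n], whereas
    [cut_norm (tri_cut A)] is at least a multiple of [log n / n], and so
    [opr_norm (tri_cut A)] is at least a multiple of [log n]. Both ratios
    diverge.

    Hilbert's inequality is obtained by Schur's test on the Gram matrix
    ([sum_sqr_le_gram]). By partial fractions, the entry of the Gram matrix at
    columns [j != k] is [2 / (j - k)^2] plus [1 / (j - k)] times the difference
    of the column sums of the kernel at [j] and [k] ([hilbert_gram]). That
    difference would spoil the bound near the ends of the range of rows; adding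
    [n] rows at either end makes it at most [2 |j - k| / n]
    ([hilbert_colsum_lip]), which is harmless. *)

(** * Schur's test *)

(** A matrix [w] has squared norm at most the norm of its Gram matrix [w^T w],
    and the norm of a symmetric matrix is at most its largest absolute row sum:
    bound each [x j * x k] by the mean of [x j ^+ 2] and [x k ^+ 2]. *)
Lemma sum_sqr_le_gram (R : realFieldType) (I J : finType) (w : I -> J -> R)
    (c : R) (x : J -> R) :
  (forall j, \sum_k `|\sum_i w i j * w i k| <= c) ->
  \sum_i (\sum_j w i j * x j) ^+ 2 <= c * \sum_j x j ^+ 2.
Proof.
move=> rowc; pose B j k := \sum_i w i j * w i k.
have BC j k : B j k = B k j by apply: eq_bigr => i _; rewrite mulrC.
have -> : \sum_i (\sum_j w i j * x j) ^+ 2 = \sum_j \sum_k B j k * (x j * x k).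
  transitivity (\sum_i \sum_j \sum_k (w i j * x j) * (w i k * x k)).
    by apply: eq_bigr => i _; rewrite expr2 big_distrlr.
  rewrite exchange_big; apply: eq_bigr => j _.
  rewrite exchange_big; apply: eq_bigr => k _.
  by rewrite mulr_suml; apply: eq_bigr => i _; rewrite mulrACA.
pose D := \sum_j \sum_k `|B j k| * x j ^+ 2.
have DC : \sum_j \sum_k `|B j k| * x k ^+ 2 = D.
  rewrite exchange_big; apply: eq_bigr => j _.
  by apply: eq_bigr => k _; rewrite BC.
have Dle : D <= c * \sum_j x j ^+ 2.
  rewrite /D mulr_sumr; apply: ler_sum => j _.
  by rewrite -mulr_suml ler_wpM2r ?sqr_ge0 ?rowc.
suff : \sum_j \sum_k B j k * (x j * x k) <= 2^-1 * (D + D) by lra.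
rewrite -{2}DC /D -big_split mulr_sumr; apply: ler_sum => j _.
rewrite -big_split mulr_sumr; apply: ler_sum => k _ /=.
have := ler_norm (B j k * (x j * x k)); rewrite normrM => h.
have xx : `|x j * x k| <= 2^-1 * (x j ^+ 2 + x k ^+ 2).
  rewrite ler_norml; have := sqr_ge0 (x j - x k); have := sqr_ge0 (x j + x k).
  by move=> *; apply/andP; split; nra.
have := ler_wpM2l (normr_ge0 (B j k)) xx; lra.
Qed.

(** * Hilbert's inequality *)

Section Hilbert.
Variable R : realFieldType.

Lemma sum_nat_indic N l : (l < N)%N ->
  \sum_(0 <= i < N) (i == l)%:R = 1 :> R.
Proof.
move=> lN; rewrite big_mkord (bigD1 (Ordinal lN)) //= eqxx big1 ?addr0 //.
by move=> i; rewrite -val_eqE /= => /negPf ->.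
Qed.

(** The convention [0^-1 = 0] makes the diagonal of the kernel vanish. *)
Definition hilbert_ker (i j : nat) : R := (i%:R - j%:R)^-1.

Lemma hilbert_kerxx i : hilbert_ker i i = 0.
Proof. by rewrite /hilbert_ker subrr invr0. Qed.

Lemma hilbert_kerC i j : hilbert_ker j i = - hilbert_ker i j.
Proof. by rewrite /hilbert_ker -invrN opprB. Qed.

Lemma hilbert_kerD m i j : hilbert_ker (m + i) (m + j) = hilbert_ker i j.
Proof. by rewrite /hilbert_ker !natrD; congr (_^-1); ring. Qed.

(** Partial fractions. The indicator terms correct the identity at [i = j] and
    [i = k], where the left-hand side is [0]. *)
Lemma hilbert_kerM i j k : j != k ->
  hilbert_ker i j * hilbert_ker i k =
  hilbert_ker j k * (hilbert_ker i j - hilbert_ker i k)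
  + ((i == j)%:R + (i == k)%:R) * hilbert_ker j k ^+ 2.
Proof.
move=> jk; have [->|ij] := eqVneq i j.
  by rewrite hilbert_kerxx ?eqxx (negPf jk) /=; ring.
have [->|ik] := eqVneq i k.
  by rewrite hilbert_kerxx ?eqxx (hilbert_kerC j k) /=; ring.
have nz a b : a != b -> a%:R - b%:R != 0 :> R by rewrite subr_eq0 eqr_nat.
by rewrite /hilbert_ker /=; field; rewrite !nz.
Qed.

Lemma hilbert_gram N j k : j != k -> (j < N)%N -> (k < N)%N ->
  \sum_(0 <= i < N) hilbert_ker i j * hilbert_ker i k =
  hilbert_ker j k * (\sum_(0 <= i < N) hilbert_ker i j
                     - \sum_(0 <= i < N) hilbert_ker i k)
  + 2 * hilbert_ker j k ^+ 2.
Proof.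
move=> jk jN kN.
under eq_bigr do rewrite hilbert_kerM //.
rewrite big_split -mulr_suml -mulr_sumr /= sumrB big_split /=.
by rewrite !sum_nat_indic.
Qed.

(** Since [m^-2 <= (m - 1/2)^-1 - (m + 1/2)^-1] for every integer [m != 0], the
    sum is dominated by a telescoping one. At [m = 0] that difference is [-4],
    which is where the bound [4] comes from. *)
Lemma sum_sqr_hilbert_ker N k : (k < N)%N ->
  \sum_(0 <= i < N) hilbert_ker i k ^+ 2 <= 4.
Proof.
move=> kN; pose g i : R := (i%:R - k%:R - 2^-1)^-1.
have le1 i : hilbert_ker i k ^+ 2 <= - (g i.+1 - g i) + (i == k)%:R * 4.
  have [->|ik] := eqVneq i k.
    rewrite hilbert_kerxx /g -natr1 expr0n /=.
    rewrite (_ : k%:R + 1 - k%:R - 2^-1 = 2^-1 :> R); last by field.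
    by rewrite (_ : k%:R - k%:R - 2^-1 = - 2^-1 :> R) ?invrN ?invrK; [lra|field].
  rewrite mul0r addr0 /g /hilbert_ker -natr1.
  set m : R := i%:R - k%:R.
  have m1 : 1 <= m ^+ 2.
    rewrite /m; have [lt|lt] : ((i.+1 <= k) \/ (k.+1 <= i))%N by lia.
      by have := lt; rewrite -(ler_nat R) -natr1; nra.
    by have := lt; rewrite -(ler_nat R) -natr1; nra.
  have m0 : m != 0 by apply/eqP => m0; move: m1; rewrite m0 expr0n /=; lra.
  have d0 : m ^+ 2 - 4^-1 != 0 by apply/eqP; lra.
  have e1 : m - 2^-1 != 0.
    by apply/eqP => h; move/eqP: d0; apply; rewrite (_ : m = 2^-1); [field|lra].
  have e2 : m + 2^-1 != 0.
    by apply/eqP => h; move/eqP: d0; apply; rewrite (_ : m = -2^-1); [field|lra].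
  have -> : i%:R + 1 - k%:R - 2^-1 = m + 2^-1 :> R by rewrite /m; field.
  have -> : - ((m + 2^-1)^-1 - (m - 2^-1)^-1) = (m ^+ 2 - 4^-1)^-1.
    have -> : m ^+ 2 - 4^-1 = (m + 2^-1) * (m - 2^-1) by field.
    by field; apply/andP; split; apply/eqP; move/eqP: e1; move/eqP: e2; lra.
  rewrite exprVn lef_pV2 ?posrE; lra.
apply: le_trans (ler_sum _ (fun i _ => le1 i)) _.
rewrite big_split /= sumrN telescope_sumr // -mulr_suml sum_nat_indic // /g.
(* The two end terms of the telescoping sum have a favourable sign. *)
have gN : 0 <= (N%:R - k%:R - 2^-1)^-1 :> R.
  by rewrite invr_ge0; move: kN; rewrite -(ler_nat R) -natr1; lra.
have g0 : (0 - k%:R - 2^-1)^-1 <= 0 :> R.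
  by rewrite invr_le0; have := ler0n R k; lra.
by rewrite /=; lra.
Qed.

(** Moving the column by one shifts the column sum along itself, so that only
    the two end terms survive; both are at most [1 / n] when the column is at
    distance at least [n] from the two ends of the window of rows. *)
Lemma hilbert_colsum_step N n j : (0 < n)%N -> (n <= j)%N -> (j + n < N)%N ->
  `|\sum_(0 <= i < N) hilbert_ker i j.+1 - \sum_(0 <= i < N) hilbert_ker i j|
  <= 2 / n%:R.
Proof.
move=> n0 nj jN; rewrite -sumrB.
have -> : \sum_(0 <= i < N) (hilbert_ker i j.+1 - hilbert_ker i j) =
    - (hilbert_ker N j.+1 - hilbert_ker 0 j.+1).
  rewrite -(telescope_sumr (fun i => hilbert_ker i j.+1)) // -sumrN.
  apply: eq_bigr => i _; rewrite opprB; congr (_ - _).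
  by rewrite -[i.+1]add1n -[j.+1]add1n hilbert_kerD.
rewrite normrN; apply: le_trans (ler_normB _ _) _.
have n0' : 0 < n%:R :> R by rewrite ltr0n.
have Nj : n%:R <= N%:R - j.+1%:R :> R.
  by move: jN; rewrite -(ler_nat R) -!natr1 natrD; lra.
have j0 : n%:R <= j.+1%:R :> R by rewrite ler_nat; lia.
rewrite /hilbert_ker sub0r invrN normrN !ger0_norm ?invr_ge0; try lra.
have h1 : (N%:R - j.+1%:R)^-1 <= n%:R^-1 :> R by rewrite lef_pV2 ?posrE; lra.
have h2 : (j.+1%:R)^-1 <= n%:R^-1 :> R by rewrite lef_pV2 ?posrE; lra.
by rewrite mulr_natl mulr2n lerD.
Qed.

(** The column sum is [2 / n]-Lipschitz in the column index, and the kernel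
    factor cancels the distance between the two columns. *)
Lemma hilbert_colsum_lip N n j k :
  (0 < n)%N -> (n <= j)%N -> (n <= k)%N -> (j + n <= N)%N -> (k + n <= N)%N ->
  `|hilbert_ker j k * (\sum_(0 <= i < N) hilbert_ker i j
                       - \sum_(0 <= i < N) hilbert_ker i k)| <= 2 / n%:R.
Proof.
move=> n0; have n0' : 0 < n%:R :> R by rewrite ltr0n.
wlog jk : j k / (j <= k)%N.
  move=> W nj nk jN kN; have [jk|/ltnW kj] := leqP j k; first exact: W.
  rewrite (_ : _ * _ = hilbert_ker k j *
    (\sum_(0 <= i < N) hilbert_ker i k - \sum_(0 <= i < N) hilbert_ker i j)).
    exact: W.
  by rewrite (hilbert_kerC j k); ring.
move=> nj _ _; rewrite -(subnKC jk); set d := (k - j)%N => kN.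
have lip : `|\sum_(0 <= i < N) hilbert_ker i j
             - \sum_(0 <= i < N) hilbert_ker i (j + d)| <= d%:R * (2 / n%:R).
  elim: d kN => [|d IH] kN; first by rewrite addn0 subrr normr0 mul0r.
  have := IH ltac:(lia).
  have := @hilbert_colsum_step N n (j + d) n0 ltac:(lia) ltac:(lia).
  rewrite -addnS distrC => h1 h2; rewrite -natr1.
  have := ler_distD (\sum_(0 <= i < N) hilbert_ker i (j + d))
    (\sum_(0 <= i < N) hilbert_ker i j)
    (\sum_(0 <= i < N) hilbert_ker i (j + d.+1)); lra.
have [d0|d0] := posnP d.
  by rewrite d0 addn0 hilbert_kerxx mul0r normr0 divr_ge0 //; lra.
have d0' : 0 < d%:R :> R by rewrite ltr0n.
rewrite normrM -(ler_pM2l d0') mulrA (_ : d%:R * `|hilbert_ker j (j + d)| = 1).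
  by rewrite mul1r.
rewrite /hilbert_ker natrD opprD addrA subrr sub0r invrN normrN.
by rewrite ger0_norm ?invr_ge0 ?(ltW d0') // mulfV // gt_eqF.
Qed.

(** Adding rows can only increase the left-hand side. With [n] extra rows on
    either side, the columns are far from the ends of the window of rows, and
    the entries of the Gram matrix are explicit up to an error [2 / n]: its
    absolute row sums are at most [4 + 2 * 4 + 2 = 14],
    which is rounded up to the square of [4]. *)
Lemma hilbert_inequality n (x : 'I_n -> R) :
  \sum_(i < n) (\sum_(j < n) hilbert_ker i j * x j) ^+ 2
  <= 16 * \sum_(j < n) x j ^+ 2.
Proof.
have [n0|n0] := posnP n.
  by subst n; rewrite !big_ord0 mulr0.
have n0' : 0 < n%:R :> R by rewrite ltr0n.
(* Column [j] is placed at position [n + j] among [3 n] rows. *)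
pose w (i : 'I_(n + (n + n))) (j : 'I_n) := hilbert_ker i (n + j).
apply: (@le_trans _ _ (\sum_i (\sum_j w i j * x j) ^+ 2)).
  rewrite [leRHS]big_split_ord /= ler_wpDl ?sumr_ge0 // => [i _|].
    exact: sqr_ge0.
  rewrite big_split_ord /= ler_wpDr ?sumr_ge0 // => [i _|].
    exact: sqr_ge0.
  apply: ler_sum => i _; rewrite le_eqVlt; apply/orP; left; apply/eqP.
  by congr (_ ^+ 2); apply: eq_bigr => j _; rewrite /w /= hilbert_kerD.
apply: sum_sqr_le_gram => j.
pose b (k : nat) : R := (k == j)%:R * 4
                        + (2 * hilbert_ker k j ^+ 2 + 2 / n%:R).
apply: (@le_trans _ _ (\sum_(0 <= k < n) b k)); last first.
  rewrite /b !big_split /= -mulr_suml -mulr_sumr sumr_const_nat subn0.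
  have := sum_sqr_hilbert_ker _ _ (ltn_ord j).
  rewrite sum_nat_indic //.
  have -> : (2 / n%:R) *+ n = 2 :> R by rewrite -mulr_natr divfK ?gt_eqF.
  lra.
rewrite big_mkord; apply: ler_sum => k _.
rewrite -(big_mkord xpredT (fun i => hilbert_ker i (n + j) * hilbert_ker i (n + k))).
have jn := ltn_ord j; have kn := ltn_ord k.
have inv0 : 0 <= 2 / n%:R :> R by rewrite divr_ge0 // ltW.
have [jk|jk] := eqVneq (j : nat) k.
  rewrite -jk ger0_norm; last by apply: sumr_ge0 => i _; rewrite -expr2 sqr_ge0.
  have := @sum_sqr_hilbert_ker (n + (n + n)) (n + j) ltac:(lia).
  rewrite /b jk eqxx; have := sqr_ge0 (hilbert_ker k k).
  under eq_bigr do rewrite -expr2; rewrite /=; lra.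
rewrite hilbert_gram ?eqn_add2l //; try lia.
have := @hilbert_colsum_lip (n + (n + n)) n (n + j) (n + k) n0
  ltac:(lia) ltac:(lia) ltac:(lia) ltac:(lia).
rewrite /b eq_sym (negPf jk) mul0r add0r [in _ * _ ^+ 2]hilbert_kerD.
rewrite (hilbert_kerC j k) sqrrN => h; apply: le_trans (ler_normD _ _) _.
by rewrite [X in _ + X <= _]ger0_norm ?(mulr_ge0 _ (sqr_ge0 _)) //; lra.
Qed.
End Hilbert.

(** * Operator norm and cut norm *)

Section Norms.
Variable R : realType.
Implicit Type n : nat.

Lemma sqr_l2norm n (x : 'cV[R]_n) : l2norm x ^+ 2 = \sum_(i < n) x i 0 ^+ 2.
Proof. by rewrite sqr_sqrtr // sumr_ge0 // => i _; rewrite sqr_ge0. Qed.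

Lemma l2norm_mul_le n (A : 'M[R]_n) (c : R) (x : 'cV[R]_n) : 0 <= c ->
  (forall y : 'I_n -> R,
     \sum_(i < n) (\sum_(j < n) A i j * y j) ^+ 2
     <= c ^+ 2 * \sum_(j < n) y j ^+ 2) ->
  l2norm x <= 1 -> l2norm (A *m x) <= c.
Proof.
move=> c0 Ac x1; rewrite -(@ler_pXn2r _ 2) ?nnegrE ?sqrtr_ge0 // sqr_l2norm.
under eq_bigr do rewrite mxE.
apply: le_trans (Ac _) _; rewrite -sqr_l2norm ler_piMr ?sqr_ge0 //.
by rewrite expr_le1 ?sqrtr_ge0.
Qed.

(** The real supremum is meaningful only for sets that are bounded above. By
    Schur's test, a crude bound suffices: the sum of all absolute
    entries of the Gram matrix bounds its row sums. *)
Lemma opr_norm_has_ubound n (A : 'M[R]_n) :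
  has_ubound [set l2norm (A *m x) | x in [set x : 'cV[R]_n | l2norm x <= 1]].
Proof.
pose d := \sum_j \sum_k `|\sum_i A i j * A i k|.
have d0 : 0 <= d by apply: sumr_ge0 => j _; apply: sumr_ge0.
exists (Num.sqrt d) => _ [x x1 <-]; apply: l2norm_mul_le => // y.
rewrite sqr_sqrtr //; apply: sum_sqr_le_gram => j.
rewrite /d [leRHS](bigD1 j) //= lerDl sumr_ge0 // => k _; exact: sumr_ge0.
Qed.

Lemma opr_norm_le n (A : 'M[R]_n) (c : R) : 0 <= c ->
  (forall y : 'I_n -> R,
     \sum_(i < n) (\sum_(j < n) A i j * y j) ^+ 2
     <= c ^+ 2 * \sum_(j < n) y j ^+ 2) ->
  opr_norm A <= c.
Proof.
move=> c0 Ac; apply: ge_sup => [|_ [x x1 <-]]; last exact: l2norm_mul_le.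
exists (l2norm (A *m 0)); exists 0 => //=.
rewrite /l2norm big1 ?sqrtr0 ?ler01 // => i _.
by rewrite mxE expr0n.
Qed.

(** This instance of the Cauchy-Schwarz inequality is Schur's test for a single
    row of ones. *)
Lemma sqr_sum_le n (x : 'I_n -> R) :
  (\sum_j x j) ^+ 2 <= n%:R * \sum_j x j ^+ 2.
Proof.
have one (F : unit -> R) : \sum_i F i = F tt.
  by rewrite (bigD1 tt) //= big1 ?addr0 // => -[].
have -> : (\sum_j x j) ^+ 2 = \sum_(i : unit) (\sum_j 1 * x j) ^+ 2.
  by rewrite one; under [in RHS]eq_bigr do rewrite mul1r.
apply: (sum_sqr_le_gram R unit 'I_n (fun _ _ => 1)) => j.
under eq_bigr do rewrite one mulr1 normr1.
by rewrite sumr_const card_ord.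
Qed.

(** The sum over a rectangle pairs the indicator of [S] with the image of the
    indicator of [T], and both indicators have Euclidean norm at most
    [sqrt n]. *)
Lemma rect_sum_le_opr_norm n (A : 'M[R]_n) (S T : {set 'I_n}) :
  `|\sum_(i in S) \sum_(j in T) A i j| <= n%:R * opr_norm A.
Proof.
have [n0|n0] := posnP n.
  subst n; rewrite mul0r big1 ?normr0 // => -[] //.
have n0' : 0 < n%:R :> R by rewrite ltr0n.
set s := \sum_(i in S) _.
(* Test the operator norm on the indicator of [T] divided by [sqrt n]. *)
pose q : R := Num.sqrt n%:R.
have qq : q ^+ 2 = n%:R by rewrite sqr_sqrtr // ltW.
pose x : 'cV[R]_n := \col_j ((j \in T)%:R / q).
have x1 : l2norm x <= 1.
  rewrite -(@ler_pXn2r _ 2) ?nnegrE ?sqrtr_ge0 ?ler01 // sqr_l2norm expr1n.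
  apply: (@le_trans _ _ (\sum_(i < n) n%:R^-1)).
    apply: ler_sum => i _; rewrite mxE expr_div_n qq ler_piMl ?invr_ge0 ?(ltW n0') //.
    by case: (_ \in _); rewrite ?expr1n ?expr0n ?ler01.
  by rewrite sumr_const card_ord -[leLHS]mulr_natr mulVf // gt_eqF.
have Ax : l2norm (A *m x) <= opr_norm A.
  by apply: ub_le_sup; [exact: opr_norm_has_ubound | exists x].
suff sAx : `|s| / n%:R <= l2norm (A *m x).
  by rewrite mulrC -ler_pdivrMr //; exact: le_trans Ax.
rewrite -(@ler_pXn2r _ 2) ?nnegrE ?sqrtr_ge0 ?divr_ge0 ?(ltW n0') // sqr_l2norm.
pose r i := \sum_(j in T) A i j.
have -> : \sum_(i < n) (A *m x) i 0 ^+ 2 = (\sum_i r i ^+ 2) / n%:R.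
  rewrite mulr_suml; apply: eq_bigr => i _; rewrite -qq -expr_div_n.
  congr (_ ^+ 2); rewrite mxE /r mulr_suml [RHS]big_mkcond; apply: eq_bigr => j _.
  by rewrite mxE; case: (_ \in _); rewrite ?mul1r // mul0r mulr0.
have : s ^+ 2 <= n%:R * \sum_i r i ^+ 2.
  rewrite /s big_mkcond; apply: le_trans (sqr_sum_le _ _) _.
  rewrite ler_pM2l //; apply: ler_sum => i _; case: ifP => // _.
  by rewrite expr0n sqr_ge0.
rewrite expr_div_n real_normK ?num_real // => h.
rewrite ler_pdivrMr ?exprn_gt0 // [leRHS](_ : _ = n%:R * \sum_i r i ^+ 2) //.
by field; rewrite gt_eqF.
Qed.

Lemma cut_norm_le_opr_norm n (A : 'M[R]_n) : cut_norm A <= opr_norm A / n%:R.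
Proof.
have [n0|n0] := posnP n.
  by subst n; rewrite /cut_norm expr0n /= !invr0 mul0r mulr0.
have n0' : 0 < n%:R :> R by rewrite ltr0n.
have -> : opr_norm A / n%:R = (n%:R ^+ 2)^-1 * (n%:R * opr_norm A).
  by field; rewrite gt_eqF.
rewrite /cut_norm ler_pM2l ?invr_gt0 ?exprn_gt0 //.
apply: ge_sup => [|_ [[S T] _ <-]]; last exact: rect_sum_le_opr_norm.
pose z := @finset.set0 'I_n.
by exists `|\sum_(i in z) \sum_(j in z) A i j|; exists (z, z).
Qed.

Lemma rect_sum_le_cut_norm n (A : 'M[R]_n) (S T : {set 'I_n}) :
  (n%:R ^+ 2)^-1 * `|\sum_(i in S) \sum_(j in T) A i j| <= cut_norm A.
Proof.
rewrite ler_wpM2l ?invr_ge0 ?sqr_ge0 //; apply: ub_le_sup; last by exists (S, T).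
by exists (n%:R * opr_norm A) => _ [[S' T'] _ <-]; exact: rect_sum_le_opr_norm.
Qed.
End Norms.

(** * The symmetric test matrix *)

Section ParityHilbert.
Variable R : realType.

(** The commutator [D H - H D] of the Hilbert kernel [H] with the diagonal matrix
    [D] of the parities. A commutator of an antisymmetric matrix with a diagonal
    one is symmetric, while its entries with odd row and even column are those
    of [H]. *)
Definition parity_hilbert_mx n : 'M[R]_n :=
  \matrix_(i, j) (((odd i)%:R - (odd j)%:R) * hilbert_ker R i j).

Lemma parity_hilbert_sym n : (parity_hilbert_mx n)^T = parity_hilbert_mx n.
Proof. by apply/matrixP => i j; rewrite !mxE hilbert_kerC; ring. Qed.

(** An odd row only sees the even entries of the vector and an even row the odd
    ones, so Hilbert's inequality for the two halves of the vector adds up to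
    the same bound for the whole. *)
Lemma opr_norm_parity_hilbert n : opr_norm (parity_hilbert_mx n) <= 4.
Proof.
apply: opr_norm_le => // y; rewrite (_ : 4 ^+ 2 = 16 :> R); last by ring.
pose y0 (j : 'I_n) := (~~ odd j)%:R * y j; pose y1 (j : 'I_n) := (odd j)%:R * y j.
have -> : \sum_j y j ^+ 2 = \sum_j y0 j ^+ 2 + \sum_j y1 j ^+ 2.
  rewrite -big_split; apply: eq_bigr => j _ /=; rewrite /y0 /y1.
  by case: (odd j) => /=; ring.
have := lerD (@hilbert_inequality R n y0) (@hilbert_inequality R n y1).
rewrite -mulrDr; apply: le_trans; rewrite -big_split; apply: ler_sum => i _ /=.
have -> : \sum_j parity_hilbert_mx n i j * y j =
    if odd i then \sum_(j < n) hilbert_ker R i j * y0 j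
    else - \sum_(j < n) hilbert_ker R i j * y1 j.
  case: ifP => oi; rewrite -?sumrN; apply: eq_bigr => j _; rewrite mxE oi /y0 /y1.
    by case: (odd j) => /=; ring.
  by case: (odd j) => /=; ring.
by case: ifP => _; rewrite ?sqrrN ?lerDl ?lerDr sqr_ge0.
Qed.

Lemma sum_nat_pairs (F : nat -> R) m :
  \sum_(0 <= i < m.*2) F i = \sum_(0 <= k < m) (F k.*2 + F k.*2.+1).
Proof.
elim: m => [|m IH]; first by rewrite !big_geq.
by rewrite doubleS !big_nat_recr //= IH addrA.
Qed.

(** The odd rows [i] with [j < i < j + K.*2] contribute [1 + 1/3 + 1/5 + ...],
    [K] terms in all, and [1 / (2k + 1) >= 1 / (2 (k + 1))]. *)
Lemma harmonic_le_odd_sum n j K : ~~ odd j -> (j + K.*2 <= n)%N ->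
  2^-1 * series harmonic K
  <= \sum_(0 <= i < n | odd i) (j <= i)%:R * hilbert_ker R i j.
Proof.
move=> ej jK.
pose F i : R := if odd i then (j <= i)%:R * hilbert_ker R i j else 0.
rewrite big_mkcond -[leRHS]/(\sum_(0 <= i < n) F i).
have F0 i : 0 <= F i.
  rewrite /F; case: ifP => // _; case: leqP => [ji|_]; last by rewrite mul0r.
  by rewrite mul1r invr_ge0 subr_ge0 ler_nat.
rewrite (@big_cat_nat _ _ _ j) //=; last lia.
rewrite [X in _ + X](@big_cat_nat _ _ _ (j + K.*2)) ?leq_addr //=.
apply: ler_wpDl; first exact: sumr_ge0.
apply: ler_wpDr; first exact: sumr_ge0.
rewrite -{1}[j]add0n big_addn addKn sum_nat_pairs /series /= mulr_sumr.
apply: ler_sum => k _.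
have Fo : F (k.*2.+1 + j)%N = (k.*2.+1%:R)^-1.
  rewrite /F oddD /= odd_double (negPf ej) /= leq_addl mul1r /hilbert_ker.
  by rewrite natrD addrK.
rewrite Fo ler_wpDl // -invfM lef_pV2 ?posrE ?mulr_gt0 ?ltr0n //.
by rewrite -natrM ler_nat; lia.
Qed.

(** Without the cut, the entries above and below the diagonal nearly cancel in
    this rectangle. The cut keeps only the positive ones, and each of the first
    [n./2 - K] even columns then contributes at least half a harmonic sum. *)
Lemma tri_cut_parity_hilbert_sum n K : (K <= n./2)%N ->
  (n./2 - K)%:R * (2^-1 * series harmonic K)
  <= \sum_(i in [set i : 'I_n | odd i]%SET) \sum_(j in [set j : 'I_n | ~~ odd j]%SET)
       tri_cut (parity_hilbert_mx n) i j.
Proof.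
move=> Kn; pose G j := \sum_(0 <= i < n | odd i) (j <= i)%:R * hilbert_ker R i j.
have G0 j : 0 <= G j.
  apply: sumr_ge0 => i _; case: leqP => [ji|_]; last by rewrite mul0r.
  by rewrite mul1r invr_ge0 subr_ge0 ler_nat.
have -> : \sum_(i in [set i : 'I_n | odd i]%SET) \sum_(j in [set j : 'I_n | ~~ odd j]%SET)
       tri_cut (parity_hilbert_mx n) i j
    = \sum_(0 <= j < n) (if odd j then 0 else G j).
  rewrite exchange_big big_mkord big_mkcond; apply: eq_bigr => j _.
  rewrite finset.in_set; case: ifPn => [ej|/negPn->] //.
  rewrite (negPf ej).
  rewrite /G big_mkord; apply: eq_big => i; rewrite finset.in_set // => oi.
  by rewrite !mxE oi (negPf ej) subr0 mul1r mulrC.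
rewrite (@big_cat_nat _ _ _ (n./2 - K).*2) //=; last lia.
apply: ler_wpDr; first by apply: sumr_ge0 => j _; case: ifP.
rewrite sum_nat_pairs mulr_natl -[X in _ *+ X]subn0 -sumr_const_nat.
rewrite !big_mkord; apply: ler_sum => k _.
have kn := ltn_ord k; rewrite /= odd_double /= addr0.
by apply: harmonic_le_odd_sum; rewrite ?odd_double //; lia.
Qed.

Lemma parity_hilbert_mx10 n (n1 : (1 < n)%N) (n0 : (0 < n)%N) :
  parity_hilbert_mx n (Ordinal n1) (Ordinal n0) = 1.
Proof. by rewrite mxE /= /hilbert_ker !subr0 invr1 mulr1. Qed.

Lemma cut_norm_parity_hilbert_gt0 n : (1 < n)%N -> 0 < cut_norm (parity_hilbert_mx n).
Proof.
move=> n1; have n0 : (0 < n)%N by lia.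
apply: (lt_le_trans _ (rect_sum_le_cut_norm _
  _ _ [set Ordinal n1]%SET [set Ordinal n0]%SET)).
rewrite !big_set1 parity_hilbert_mx10 normr1 mulr1.
by rewrite invr_gt0 exprn_gt0 // ltr0n.
Qed.

(** For [n >= 8 K + 8] the number [n./2 - K] of good columns is at least
    [n / 8]. *)
Lemma cut_norm_tri_cut_ge n K : (K.*2.*2.*2 + 8 <= n)%N ->
  series harmonic K / 16 / n%:R <= cut_norm (tri_cut (parity_hilbert_mx n)).
Proof.
move=> Kn; have n0 : 0 < n%:R :> R by rewrite ltr0n; lia.
apply: le_trans (rect_sum_le_cut_norm _ _ _ [set i : 'I_n | odd i]%SET
  [set j : 'I_n | ~~ odd j]%SET).
have h0 : 0 <= series harmonic K :> R.
  by apply: sumr_ge0 => k _; exact: harmonic_ge0.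
have -> : series harmonic K / 16 / n%:R =
    (n%:R ^+ 2)^-1 * (n%:R / 8 * (2^-1 * series harmonic K)) :> R.
  by field; rewrite gt_eqF.
rewrite ler_pM2l ?invr_gt0 ?exprn_gt0 //; apply: le_trans (ler_norm _).
apply: le_trans (@tri_cut_parity_hilbert_sum n K ltac:(lia)).
rewrite ler_wpM2r ?mulr_ge0 // ?invr_ge0 // ler_pdivrMr // -natrM ler_nat.
lia.
Qed.

Lemma cut_norm_tri_cut_ratio n K : (K.*2.*2.*2 + 8 <= n)%N ->
  series harmonic K / 64
  <= cut_norm (tri_cut (parity_hilbert_mx n)) / cut_norm (parity_hilbert_mx n).
Proof.
move=> Kn; have n0 : 0 < n%:R :> R by rewrite ltr0n; lia.
have h0 : 0 <= series harmonic K :> R.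
  by apply: sumr_ge0 => k _; exact: harmonic_ge0.
rewrite ler_pdivlMr; last by apply: cut_norm_parity_hilbert_gt0; lia.
apply: le_trans (cut_norm_tri_cut_ge _ _ Kn).
have -> : series harmonic K / 16 / n%:R = series harmonic K / 64 * (4 / n%:R) :> R.
  by field; rewrite gt_eqF.
rewrite ler_wpM2l ?divr_ge0 //; apply: le_trans (cut_norm_le_opr_norm _ _ _) _.
by rewrite ler_pM2r ?invr_gt0 // opr_norm_parity_hilbert.
Qed.

Lemma opr_norm_tri_cut_ratio n K : (K.*2.*2.*2 + 8 <= n)%N ->
  series harmonic K / 64
  <= opr_norm (tri_cut (parity_hilbert_mx n)) / opr_norm (parity_hilbert_mx n).
Proof.
move=> Kn; have n0 : 0 < n%:R :> R by rewrite ltr0n; lia.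
have h0 : 0 <= series harmonic K :> R.
  by apply: sumr_ge0 => k _; exact: harmonic_ge0.
have opr_gt0 : 0 < opr_norm (parity_hilbert_mx n).
  rewrite -(@pmulr_lgt0 _ n%:R^-1) ?invr_gt0 //.
  apply: lt_le_trans (cut_norm_le_opr_norm _ _ _).
  by apply: cut_norm_parity_hilbert_gt0; lia.
rewrite ler_pdivlMr //; apply: (@le_trans _ _ (series harmonic K / 16)).
  have := ler_wpM2l h0 (opr_norm_parity_hilbert n); lra.
rewrite -(@ler_pM2r _ n%:R^-1) ?invr_gt0 //.
exact: le_trans (cut_norm_tri_cut_ge _ _ Kn) (cut_norm_le_opr_norm _ _ _).
Qed.

(** Generic in the norm and in the class of matrices, so that the three limits
    are instances; [K] is chosen first, by divergence of the harmonic series. *)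
Lemma sup_ratio_parity_hilbert_dvg (N : forall n, 'M[R]_n -> R)
    (D : forall n, set 'M[R]_n) :
  (forall n, D n (parity_hilbert_mx n)) ->
  (forall n K, (K.*2.*2.*2 + 8 <= n)%N ->
     series harmonic K / 64
     <= N n (tri_cut (parity_hilbert_mx n)) / N n (parity_hilbert_mx n)) ->
  sup_ratio (N n) (D n) @[n --> \oo] --> +oo%E.
Proof.
move=> DP ratio; apply/cvgeyPge => M.
have harmonic_oo : series (@harmonic R) @ \oo --> +oo.
  apply: nondecreasing_dvgn_lt (@dvg_harmonic R).
  by apply: nondecreasing_series => k _ _; exact: harmonic_ge0.
have [K _ /(_ K (leqnn K)) MK] := (cvgryPge _).1 harmonic_oo (M * 64).
exists (K.*2.*2.*2 + 8)%N => // n /= Kn.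
apply: le_ereal_sup_tmp.
exists (N n (tri_cut (parity_hilbert_mx n)) / N n (parity_hilbert_mx n))%:E.
  exists (parity_hilbert_mx n) => //; split => //=; apply/eqP => A0.
  have n1 : (1 < n)%N by lia.
  have n0 : (0 < n)%N by lia.
  have := congr1 (fun A : 'M[R]_n => A (Ordinal n1) (Ordinal n0)) A0.
  by rewrite parity_hilbert_mx10 mxE => /eqP; rewrite oner_eq0.
rewrite lee_fin; apply: le_trans (ratio _ _ Kn).
by rewrite ler_pdivlMr.
Qed.
End ParityHilbert.

Theorem proposition3p3 (R : realType) :
  [/\ sup_ratio (@cut_norm R n) [set: 'M[R]_n] @[n --> \oo] --> +oo%E,
      sup_ratio (@cut_norm R n) (@sym_mx R n) @[n --> \oo] --> +oo%E
    & sup_ratio (@opr_norm R n) (@sym_mx R n) @[n --> \oo] --> +oo%E].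
Proof.
split; apply: (@sup_ratio_parity_hilbert_dvg R) => n.
- by [].
- exact: cut_norm_tri_cut_ratio.
- exact: parity_hilbert_sym.
- exact: cut_norm_tri_cut_ratio.
- exact: parity_hilbert_sym.
- exact: opr_norm_tri_cut_ratio.
Qed.
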